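(* Let $m\ge 2$, $n\ge1$, $\varepsilon\in[0,1/2)$, $\delta\ge 0$. Suppose the $m$ datasets $\{x_{1i}\}_{i=1}^n,\dots,\{x_{mi}\}_{i=1}^n$ are statistically independent and there exists $\boldsymbol\theta^\star\in\mathbb{R}^m$ and $S\subseteq[m]$ with $|S^c|/m\le\varepsilon$ and $\min_{\theta\in\mathbb{R}}\max_{j\in S}|\theta^\star_j-\theta|\le\delta$, such that for each $j\in[m]$, $\{x_{ji}\}_{i=1}^n$ are i.i.d. $N(\theta^\star_j,1)$. Let $f_j(\theta)=\frac1{2n}\sum_{i=1}^n(x_{ji}-\theta)^2$ and let $(\widehat\theta_1,\dots,\widehat\theta_m,\widehat\theta)$ be any minimizer of $\sum_{j=1}^m[f_j(\theta_j)+\lambda|\theta_j-\theta|]$ over $\theta_1,\dots,\theta_m,\theta\in\mathbb{R}$. Choose any $t\ge1$, $c\in[\varepsilon,1/2)$ and $$\lambda=\frac{5}{1-2c}\sqrt{\frac{2(\log m+t)}{n}}.$$ Then there exists a universal constant $C>0$ such that with probability at least $1-e^{-t}$, $$\max_{j\in S}|\widehat\theta_j-\theta^\star_j|<\frac{C}{(1-2c)^2}\Big(\sqrt{\frac{t}{mn}}+\min\Big\{\delta,\sqrt{\frac{\log m+t}{n}}\Big\}+\varepsilon\sqrt{\frac{\log m+t}{n}}\Big),$$ $$\max_{j\in S^c}|\widehat\theta_j-\theta^\star_j|<\frac{C}{(1-2c)^2}\sqrt{\frac{\log m+t}{n}}.$$ *)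

(* Defs.v *)
From HB Require Import structures.
From mathcomp Require Import all_boot all_order all_algebra.
From mathcomp Require Import all_classical all_reals all_analysis.
Set Implicit Arguments. Unset Strict Implicit. Unset Printing Implicit Defensive.
Import Order.TTheory GRing.Theory Num.Theory.
Local Open Scope classical_set_scope.
Local Open Scope ring_scope.

(* Mutual independence of a finite family of real random variables:
   the joint law factorizes on all boxes of Borel sets (taking some B i = setT
   gives the product rule for every subfamily). *)
Definition mutually_independent {d} {T : measurableType d} {R : realType}
  (P : probability T R) {I : finType} (X : I -> T -> R) : Prop :=
  forall B : I -> set R, (forall i, measurable (B i)) ->
    P (\bigcap_(i in [set: I]) (X i @^-1` B i)) =
    (\prod_(i : I) P (X i @^-1` B i))%E.

Definition fj {R : realType} {n : nat} (xj : 'I_n -> R) (th : R) : R :=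
  (2 * n%:R)^-1 * \sum_(i < n) (xj i - th) ^+ 2.

Definition objective {R : realType} {m n : nat} (lam : R)
  (x : 'I_m -> 'I_n -> R) (ths : 'I_m -> R) (th : R) : R :=
  \sum_(j < m) (fj (x j) (ths j) + lam * `|ths j - th|).

Definition is_minimizer {R : realType} {m n : nat} (lam : R)
  (x : 'I_m -> 'I_n -> R) (ths : 'I_m -> R) (th : R) : Prop :=
  forall (ths' : 'I_m -> R) (th' : R),
    objective lam x ths th <= objective lam x ths' th'.

(* Main.v *)
(* Let y_j be the mean of the j-th dataset and r_j = y_j - ths_j the residuals
   of a minimizer.  Comparing the objective with perturbed points shows that
   |r_j| <= lam, that r_j = lam (resp. -lam) when ths_j > th (resp. < th), and
   that the residuals sum to 0.  Put q = sqrt ((log m + t) / n); with high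
   probability |y_j - thstar_j| < 2q for all j, so every coordinate has error
   at most lam + 2q.  When delta <= q the means in S lie within 6q of each
   other; if some ths_j, j in S, differed from th, then all residuals in S
   would be at least lam - 6q with the same sign, and since S^c has at most
   c m elements they could not sum to 0.  Hence ths_j = th on S, and the zero
   sum of the residuals puts th within 2 eps lam of the mean of the y_j over S.
   The deviations are controlled by Chernoff's bound. *)

Require Import Defs.
From HB Require Import structures.
From mathcomp Require Import all_boot all_order all_algebra.
From mathcomp Require Import all_classical all_reals all_analysis.
From mathcomp Require Import measurable_realfun ring lra.
Import Order.TTheory GRing.Theory Num.Theory.
Local Open Scope classical_set_scope.
Local Open Scope ring_scope.

(** * Optimality conditions for the penalized least-squares objective *)

Section minimizer.
Context {R : realType} {m n : nat}.
Implicit Types (lam th : R) (x : 'I_m -> 'I_n -> R) (ths : 'I_m -> R).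

Definition sample_mean (xj : 'I_n -> R) : R := (\sum_(i < n) xj i) / n%:R.

(** [fj xj] is a quadratic with derivative [a - sample_mean xj] at [a] and second derivative 1, so
    its Taylor expansion is exact. All perturbations of the objective are evaluated through it. *)
Lemma fj_add (xj : 'I_n -> R) (a h : R) : (0 < n)%N ->
  fj xj (a + h) = fj xj a + (h * (a - sample_mean xj) + h ^+ 2 / 2).
Proof.
move=> n0; have nz : n%:R != 0 :> R by rewrite pnatr_eq0 -lt0n.
rewrite /fj /sample_mean.
have -> : \sum_(i < n) (xj i - (a + h)) ^+ 2 =
    \sum_(i < n) (xj i - a) ^+ 2 - 2 * h * \sum_(i < n) xj i
    + n%:R * (2 * h * a + h ^+ 2).
  have -> : n%:R * (2 * h * a + h ^+ 2) = \sum_(i < n) (2 * h * a + h ^+ 2).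
    by rewrite sumr_const card_ord mulr_natl.
  rewrite mulr_sumr -sumrB -big_split/=; apply: eq_bigr => i _; ring.
by field.
Qed.

(** Moving one coordinate changes a single summand of the objective. Suitable choices of [h] then
    give the size and sign of each residual. *)
Lemma minimizer_shift_coord lam x ths th j h : (0 < n)%N ->
  is_minimizer lam x ths th ->
  0 <= h * (ths j - sample_mean (x j)) + h ^+ 2 / 2
       + lam * (`|ths j + h - th| - `|ths j - th|).
Proof.
move=> n0 /(_ (fun k => if k == j then ths k + h else ths k) th).
rewrite /objective (bigD1 j)//= [leRHS](bigD1 j)//= eqxx fj_add//.
rewrite [X in _ + X <= _ -> _](eq_bigr (fun k =>
  fj (x k) (if k == j then ths k + h else ths k) +
  lam * `|(if k == j then ths k + h else ths k) - th|)); last first.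
  by move=> k /negPf ->.
lra.
Qed.

(* Translate all the coordinates simultaneously: the penalty does not change. *)
Lemma minimizer_residual_sum lam x ths th : (0 < n)%N ->
  is_minimizer lam x ths th ->
  \sum_(j < m) (sample_mean (x j) - ths j) = 0.
Proof.
move=> n0 min; have [m0|m0] := posnP m.
  by rewrite big1// => k _; have := ltn_ord k; rewrite [X in (_ < X)%N]m0.
have nz : m%:R != 0 :> R by rewrite pnatr_eq0 -lt0n.
(* Translating by the mean residual [r / m] changes the objective by [- r ^+ 2 / (2 * m)], which
   minimality forces to be nonnegative. *)
set r := \sum_(j < m) _; have := min (fun k => ths k + r / m%:R) (th + r / m%:R).
rewrite /objective [leRHS](eq_bigr (fun j => fj (x j) (ths j) +
    lam * `|ths j - th| + (r / m%:R * (ths j - sample_mean (x j))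
    + (r / m%:R) ^+ 2 / 2))); last first.
  by move=> j _; rewrite fj_add// opprD addrACA subrr addr0 addrAC.
rewrite [leRHS]big_split/= lerDl big_split/= sumr_const card_ord -mulr_sumr.
have -> : \sum_(j < m) (ths j - sample_mean (x j)) = - r.
  by rewrite -sumrN; apply: eq_bigr => j _; rewrite opprB.
rewrite -[X in _ + X]mulr_natl.
have -> : r / m%:R * - r + m%:R * ((r / m%:R) ^+ 2 / 2) = - (r ^+ 2 / (2 * m%:R)).
  by field.
rewrite oppr_ge0 pmulr_lle0 ?invr_gt0 ?mulr_gt0 ?ltr0n// => r0.
by apply/eqP; rewrite -sqrf_eq0 eq_le r0 sqr_ge0.
Qed.

(** The penalty is [lam]-Lipschitz in [ths j], so with a larger residual a move towards the sample
    mean would gain more than it costs. *)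
Lemma minimizer_residual_le lam x ths th j : (0 < n)%N -> 0 <= lam ->
  is_minimizer lam x ths th -> `|sample_mean (x j) - ths j| <= lam.
Proof.
move=> n0 l0 min; set r := sample_mean (x j) - ths j.
have H h : 0 <= - h * r + h ^+ 2 / 2 + lam * `|h|.
  have := minimizer_shift_coord _ _ _ _ j h n0 min.
  have : `|ths j + h - th| <= `|ths j - th| + `|h|.
    by rewrite addrAC ler_normD.
  move=> /(ler_wpM2l l0); rewrite /r; lra.
rewrite ler_norml; apply/andP; split; rewrite leNgt; apply/negP => rl.
  (* The shift [h] is the excess of [r] beyond the interval from [- lam] to [lam]; it bounds the
     change by [- h ^+ 2 / 2]. *)
  by have := H (r + lam); rewrite ltr0_norm; [nra|lra].
by have := H (r - lam); rewrite gtr0_norm; [nra|lra].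
Qed.

Lemma minimizer_residual_above lam x ths th j : (0 < n)%N ->
  is_minimizer lam x ths th -> th < ths j ->
  lam <= sample_mean (x j) - ths j.
Proof.
move=> n0 min lt; rewrite leNgt; apply/negP => rl.
set r := sample_mean (x j) - ths j in rl.
(* The first bound keeps the move from crossing [th], so the penalty drops by exactly [lam * k]; the
   second makes the total change at most [- k ^+ 2 / 2]. *)
pose k := Num.min (ths j - th) (lam - r).
have k0 : 0 < k by rewrite lt_min !subr_gt0 lt rl.
have k1 : k <= ths j - th by rewrite ge_min lexx.
have k2 : k <= lam - r by rewrite ge_min lexx orbT.
have := minimizer_shift_coord _ _ _ _ j (- k) n0 min.
rewrite ger0_norm ?ger0_norm; [rewrite -/r in rl *|lra..].
have -> : ths j - sample_mean (x j) = - r by rewrite /r opprB.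
nra.
Qed.

Lemma minimizer_residual_below lam x ths th j : (0 < n)%N ->
  is_minimizer lam x ths th -> ths j < th ->
  sample_mean (x j) - ths j <= - lam.
Proof.
move=> n0 min lt; rewrite leNgt; apply/negP => rl.
set r := sample_mean (x j) - ths j in rl.
pose k := Num.min (th - ths j) (lam + r).
have k0 : 0 < k by rewrite lt_min subr_gt0 lt; lra.
have k1 : k <= th - ths j by rewrite ge_min lexx.
have k2 : k <= lam + r by rewrite ge_min lexx orbT.
have := minimizer_shift_coord _ _ _ _ j k n0 min.
rewrite ler0_norm ?ler0_norm; [rewrite -/r in rl *|lra..].
have -> : ths j - sample_mean (x j) = - r by rewrite /r opprB.
nra.
Qed.

(** One coordinate of [S] off [th] would push every residual in [S] to at least [lam - D] in
    absolute value with a common sign, more than the residuals outside [S] can cancel. *)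
Lemma minimizer_consensus lam x ths th (S : {set 'I_m}) (D : R) :
  (0 < n)%N -> 0 <= lam -> is_minimizer lam x ths th ->
  (forall j k, j \in S -> k \in S ->
     `|sample_mean (x j) - sample_mean (x k)| <= D) ->
  #|~: S|%:R * lam < #|S|%:R * (lam - D) ->
  forall j, j \in S -> ths j = th.
Proof.
move=> n0 l0 min close big j jS.
have sum0 := minimizer_residual_sum _ _ _ _ n0 min.
have split_sum (f : 'I_m -> R) :
    \sum_(k < m) f k = \sum_(k in S) f k + \sum_(k in ~: S) f k.
  rewrite (bigID (mem S))/=; congr (_ + _).
  by apply: eq_bigl => k; rewrite inE.
have cst (A : {set 'I_m}) (a : R) : \sum_(k in A) a = #|A|%:R * a.
  by rewrite sumr_const mulr_natl.
have lamD : 0 < lam - D.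
  have S0 : 0 < #|S|%:R :> R by rewrite ltr0n card_gt0; apply/set0Pn; exists j.
  rewrite -(pmulr_rgt0 _ S0); apply: le_lt_trans big.
  by rewrite mulr_ge0// ler0n.
have D0 : 0 <= D by rewrite (le_trans _ (close j j jS jS)).
have res k := minimizer_residual_le _ _ _ _ k n0 l0 min.
apply/eqP/negPn/negP; rewrite neq_lt => /orP[lt|lt].
- have rj := minimizer_residual_below _ _ _ _ _ n0 min lt.
  have : \sum_(k < m) (sample_mean (x k) - ths k) <=
      #|S|%:R * - (lam - D) + #|~: S|%:R * lam.
    rewrite split_sum -!cst; apply: lerD; apply: ler_sum => k kS; last first.
      by have := res k; rewrite ler_norml => /andP[].
    (* On the side of [j] the residual is at most [- lam]. Otherwise [ths j < th <= ths k] and the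
       means differ by at most [D], so the residual of [k] exceeds that of [j] by at most [D]. *)
    have [ltk|gek] := ltP (ths k) th.
      by have := minimizer_residual_below _ _ _ _ _ n0 min ltk; lra.
    by have := close j k jS kS; rewrite ler_norml => /andP[]; lra.
  rewrite sum0; lra.
- have rj := minimizer_residual_above _ _ _ _ _ n0 min lt.
  have : #|S|%:R * (lam - D) + #|~: S|%:R * - lam <=
      \sum_(k < m) (sample_mean (x k) - ths k).
    rewrite split_sum -!cst; apply: lerD; apply: ler_sum => k kS; last first.
      by have := res k; rewrite ler_norml => /andP[].
    have [ltk|gek] := ltP th (ths k).
      by have := minimizer_residual_above _ _ _ _ _ n0 min ltk; lra.
    by have := close j k jS kS; rewrite ler_norml => /andP[]; lra.
  rewrite sum0; lra.
Qed.

(** By the zero total, the residuals in [S] sum to minus those outside, each of size at most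
    [lam]. *)
Lemma minimizer_consensus_center lam x ths th (S : {set 'I_m}) :
  (0 < n)%N -> 0 <= lam -> is_minimizer lam x ths th ->
  (forall j, j \in S -> ths j = th) ->
  `|\sum_(j in S) (sample_mean (x j) - th)| <= #|~: S|%:R * lam.
Proof.
move=> n0 l0 min eqth.
have := minimizer_residual_sum _ _ _ _ n0 min.
rewrite (bigID (mem S))/= => /eqP; rewrite addr_eq0 => /eqP.
under eq_bigr => j jS do rewrite eqth//.
move=> ->; rewrite normrN (le_trans (ler_norm_sum _ _ _))//.
rewrite mulr_natl -sumr_const.
rewrite [leLHS](eq_bigl (mem (~: S))) => [|k]; last by rewrite /= inE.
apply: ler_sum => k _; exact: minimizer_residual_le.
Qed.

End minimizer.

Import HBNNSimple.

(** * Weighted integrals are determined by their values on indicators *)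

Section weighted_integral.
Context {R : realType} {d : measure_display} {T : measurableType d}.
Local Open Scope ereal_scope.

(** Monotone convergence along simple approximations of [g]. The right-hand side sees [mu], [w] and
    [X] only through weighted integrals of indicators, so it can be compared across different
    spaces. *)
Lemma weighted_integral_approx (mu : {measure set T -> \bar R})
    (w : T -> R) (X : T -> R) (g : R -> R) (mg : measurable_fun setT ((EFin \o g) : R -> \bar R)) :
  measurable_fun setT w -> (forall z, (0 <= w z)%R) ->
  measurable_fun setT X -> (forall y, (0 <= g y)%R) ->
  let g_ := nnsfun_approx measurableT mg in
  \int[mu]_z (w z * g (X z))%:E =
  limn (fun k => \sum_(y \in range (g_ k))
    y%:E * \int[mu]_z (w z * \1_(g_ k @^-1` [set y]) (X z))%:E).
Proof.
move=> mw w0 mX g0 g_.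
have mgX k : measurable_fun setT (fun z => g_ k (X z)) by exact: measurableT_comp.
transitivity (limn (fun k => \int[mu]_z (w z * g_ k (X z))%:E)).
  rewrite -monotone_convergence//.
  - apply: eq_integral => z _; apply/esym/cvg_lim => //=.
    under eq_fun do rewrite EFinM; rewrite EFinM.
    apply: cvgeZl => //.
    by apply: (@cvg_nnsfun_approx _ _ _ _ measurableT _ mg) => // y _; rewrite lee_fin.
  - by move=> k; exact/measurable_EFinP/measurable_funM.
  - by move=> k z _; rewrite lee_fin mulr_ge0.
  - move=> z _ a b ab; rewrite lee_fin ler_wpM2l//.
    exact/lefP/nd_nnsfun_approx.
congr (limn _); apply/funext => k.
have m1 y : measurable_fun setT (fun z => \1_(g_ k @^-1` [set y]) (X z) : R).
  exact: measurableT_comp.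
transitivity (\int[mu]_z (\sum_(y \in range (g_ k))
    (y * (w z * \1_(g_ k @^-1` [set y]) (X z)))%:E)).
  apply: eq_integral => z _; rewrite [in LHS]fimfunE !fsbig_finite//=.
  by rewrite mulr_sumr -sumEFin; apply: eq_bigr => y _; rewrite mulrCA.
rewrite ge0_integral_fsum//; last 2 first.
- by move=> y; exact/measurable_EFinP/measurable_funM/measurable_funM.
- move=> y z _; rewrite mulrCA EFinM mule_ge0 ?lee_fin//.
  by have := nnfun_muleindic_ge0 (g_ k) y (X z).
apply: eq_fsbigr => y /[!inE] -[z _ <-].
under eq_integral do rewrite EFinM.
rewrite ge0_integralZl_EFin//.
- by move=> ? _; rewrite lee_fin mulr_ge0.
- exact/measurable_EFinP/measurable_funM.
Qed.
End weighted_integral.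

(** This serves twice: with the other factors of a product as weight, for independence, and with a
    density as weight, for the change of variables. *)
Lemma eq_weighted_integral {R : realType} {d1 d2 : measure_display}
    {T1 : measurableType d1} {T2 : measurableType d2}
    (mu1 : {measure set T1 -> \bar R}) (mu2 : {measure set T2 -> \bar R})
    (w1 X1 : T1 -> R) (w2 X2 : T2 -> R) (g : R -> R) :
  measurable_fun setT w1 -> (forall z, 0 <= w1 z) -> measurable_fun setT X1 ->
  measurable_fun setT w2 -> (forall z, 0 <= w2 z) -> measurable_fun setT X2 ->
  measurable_fun setT g -> (forall y, 0 <= g y) ->
  (forall B, measurable B ->
    (\int[mu1]_z (w1 z * \1_B (X1 z))%:E = \int[mu2]_z (w2 z * \1_B (X2 z))%:E)%E) ->
  (\int[mu1]_z (w1 z * g (X1 z))%:E = \int[mu2]_z (w2 z * g (X2 z))%:E)%E.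
Proof.
move=> mw1 w10 mX1 mw2 w20 mX2 mg g0 H.
have mg' : measurable_fun setT ((EFin \o g) : R -> \bar R) by exact/measurable_EFinP.
rewrite (weighted_integral_approx mu1 w1 X1 g mg')//.
rewrite (weighted_integral_approx mu2 w2 X2 g mg')//.
congr (limn _); apply/funext => k; apply: eq_fsbigr => y _; congr (_ * _)%E.
exact: H.
Qed.

(** * Product rule for expectations of independent variables *)

Section independence.
Context {R : realType} {d : measure_display} {T : measurableType d}.
Variables (P : probability T R) (I : finType) (X : I -> T -> R).
Hypothesis mX : forall p, measurable_fun setT (X p).

Lemma independent_integral_prod (h : I -> R -> R) :
  mutually_independent P X ->
  (forall p, measurable_fun setT (h p)) -> (forall p y, 0 <= h p y) ->
  (forall p, \int[P]_w (h p (X p w))%:E < +oo)%E ->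
  (\int[P]_w (\prod_p h p (X p w))%:E = \prod_p \int[P]_w (h p (X p w))%:E)%E.
Proof.
move=> indep.
(* Independence speaks of Borel boxes, that is, of products of indicators. The induction is on a
   list [s] outside which every factor is an indicator. *)
suff H (s : seq I) : forall h : I -> R -> R,
    (forall p, measurable_fun setT (h p)) -> (forall p y, 0 <= h p y) ->
    (forall p, \int[P]_w (h p (X p w))%:E < +oo)%E ->
    (forall p, p \notin s -> exists2 B, measurable B & h p = \1_B) ->
    (\int[P]_w (\prod_p h p (X p w))%:E = \prod_p \int[P]_w (h p (X p w))%:E)%E.
  move=> mh h0 hoo; apply: (H (enum I)) => // p; by rewrite mem_enum.
(* Indicators are replaced by arbitrary functions one index at a time. *)
elim: s => [|q s IH] {}h mh h0 hoo ind.
  have /choice[B HB] p : exists B, measurable B /\ h p = \1_B.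
    by have [B mB hB] := ind p isT; exists B.
  have mB p : measurable (X p @^-1` B p).
    by rewrite -[_ @^-1` _]setTI; apply: mX => //; exact: (HB p).1.
  transitivity (P (\bigcap_(i in [set: I]) (X i @^-1` B i))).
    set D := \bigcap_(_ in _) _.
    have mD : measurable D by exact: fin_bigcap_measurable.
    rewrite -(setIT D) -integral_indic//.
    apply: eq_integral => w _; congr EFin.
    rewrite indicE; case: (boolP (w \in _)) => [/set_mem wB|wB].
      rewrite big1// => p _; rewrite (HB p).2 indicE mem_set//.
      exact: (wB p).
    apply/eqP/prodf_eq0; apply: contrapT => nex; move: wB; apply/negP.
    rewrite negbK; apply/mem_set => p _ /=; apply: contrapT => nB.
    by apply: nex; exists p => //; rewrite (HB p).2 indicE memNset.
  rewrite indep => [|p]; last exact: (HB p).1.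
  apply: eq_bigr => p _; rewrite (HB p).2.
  rewrite -[in LHS](setIT (X p @^-1` B p)) -integral_indic//.
pose w (z : T) : R := \prod_(p | p != q) h p (X p z).
have mw : measurable_fun setT w.
  rewrite (_ : w = fun z => \prod_p (if p != q then h p (X p z) else 1)).
    by apply: measurable_prod => p _; case: (p != q) => //=; exact: measurableT_comp.
  by apply/funext => z; rewrite /w big_mkcond.
have w0 z : 0 <= w z by exact: prodr_ge0.
pose k : R := fine (\prod_(p | p != q) \int[P]_z (h p (X p z))%:E)%E.
have kE : (\prod_(p | p != q) \int[P]_z (h p (X p z))%:E)%E = k%:E.
  rewrite fineK//; apply: (big_ind (fun x => x \is a fin_num)) => //.
    by move=> ? ?; exact: fin_numM.
  move=> p _; rewrite ge0_fin_numE//.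
  by apply: integral_ge0 => z _; rewrite lee_fin.
have k0 : 0 <= k.
  rewrite -lee_fin -kE; apply: prode_ge0 => p _.
  by apply: integral_ge0 => z _; rewrite lee_fin.
rewrite (bigD1 q)//= kE.
transitivity (\int[P]_z (w z * h q (X q z))%:E)%E.
  by apply: eq_integral => z _; rewrite (bigD1 q)//= mulrC.
(* The random weight [w] of the other factors is traded for the constant [k], the product of their
   integrals. Only indicators at [q] remain to be compared, and there the induction hypothesis
   applies to [h']. *)
rewrite (eq_weighted_integral P P w (X q) (cst k) (X q))//.
  under eq_integral do rewrite EFinM.
  rewrite ge0_integralZl_EFin//; first by rewrite muleC.
    by move=> z _; rewrite lee_fin.
  by apply/measurable_EFinP; exact: measurableT_comp.
move=> B mB.
pose h' p := if p == q then \1_B else h p.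
have mXB : measurable (X q @^-1` B).
  by rewrite -[_ @^-1` _]setTI; exact: mX.
have indic_lty : (\int[P]_z (\1_B (X q z))%:E < +oo)%E.
  have <- : P (X q @^-1` B `&` setT) = (\int[P]_z (\1_B (X q z))%:E)%E.
    by rewrite -integral_indic.
  by rewrite setIT (le_lt_trans (probability_le1 _ _)) ?ltry.
have h'q : h' q = \1_B by rewrite /h' eqxx.
have h'p p : p != q -> h' p = h p by rewrite /h' => /negPf ->.
transitivity (\int[P]_z (\prod_p h' p (X p z))%:E)%E.
  apply: eq_integral => z _; rewrite (bigD1 q)//= h'q mulrC; congr (_ * _)%:E.
  by apply: eq_bigr => p pq; rewrite h'p.
have mh' p : measurable_fun setT (h' p).
  by have [->|pq] := eqVneq p q; rewrite ?h'q ?h'p.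
have h'0 p y : 0 <= h' p y.
  by have [->|pq] := eqVneq p q; rewrite ?h'q ?h'p.
have h'oo p : (\int[P]_z (h' p (X p z))%:E < +oo)%E.
  by have [->|pq] := eqVneq p q; rewrite ?h'q ?h'p.
have ind' p : p \notin s -> exists2 B, measurable B & h' p = \1_B.
  move=> ps; have [->|pq] := eqVneq p q; first by rewrite h'q; exists B.
  by rewrite h'p//; apply: ind; rewrite inE negb_or pq.
rewrite IH//.
under [RHS]eq_integral do rewrite EFinM.
rewrite ge0_integralZl_EFin//; last first.
  by apply/measurable_EFinP; exact: measurableT_comp.
rewrite (bigD1 q)//= h'q muleC -kE; congr (_ * _)%E.
by apply: eq_bigr => p pq; rewrite h'p.
Qed.

End independence.

(** * Gaussian moment generating function and Chernoff bounds *)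

Section gaussian.
Context {R : realType} {d : measure_display} {T : measurableType d}.
Variable P : probability T R.

(** Weight 1 with the variable [X] under [P], and the density with the identity under Lebesgue
    measure, agree on indicators by the assumed law. *)
Lemma normal_law_integral (X : T -> R) (m s : R) (g : R -> R) :
  measurable_fun setT X ->
  (forall A, measurable A -> P (X @^-1` A) = normal_prob m s A) ->
  measurable_fun setT g -> (forall y, 0 <= g y) ->
  (\int[P]_w (g (X w))%:E =
   \int[lebesgue_measure]_y (normal_pdf m s y * g y)%:E)%E.
Proof.
move=> mX law mg g0.
transitivity (\int[P]_w (1 * g (X w))%:E)%E.
  by under [RHS]eq_integral do rewrite mul1r.
apply: (eq_weighted_integral P lebesgue_measure (cst 1) X
  (normal_pdf m s) idfun) => //.
- exact: measurable_normal_pdf.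
- by move=> y; exact: normal_pdf_ge0.
- exact: measurable_id.
move=> B mB; transitivity (P (X @^-1` B)).
  under eq_integral do rewrite mul1r.
  rewrite -(setIT (X @^-1` B)) -integral_indic//.
  by rewrite -[_ @^-1` _]setTI; exact: mX.
rewrite law// /normal_prob [LHS]integral_mkcond; congr integral.
apply/funext => y /=.
rewrite patchE indicE; case: ifPn => _; by rewrite ?mulr1 ?mulr0.
Qed.

Lemma normal_law_mgf (X : T -> R) (m r : R) :
  measurable_fun setT X ->
  (forall A, measurable A -> P (X @^-1` A) = normal_prob m 1 A) ->
  (\int[P]_w (expR (r * (X w - m)))%:E = (expR (r ^+ 2 / 2))%:E)%E.
Proof.
move=> mX law.
rewrite (normal_law_integral X m 1 (fun y => expR (r * (y - m))))//; last first.
  apply: measurableT_comp => //; apply: measurable_funM => //.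
  exact: measurable_funB.
(* Exponential tilting turns N(m, 1) into N(m + r, 1). *)
transitivity (\int[lebesgue_measure]_y
    ((expR (r ^+ 2 / 2))%:E * (normal_pdf (m + r) 1 y)%:E))%E.
  apply: eq_integral => y _; rewrite -EFinM !normal_pdfE ?oner_neq0//.
  rewrite /normal_fun mulrCA -mulrA -!expRD; congr (_ * expR _)%:E.
  by field.
rewrite ge0_integralZl_EFin ?expR_ge0//.
- by rewrite integral_normal_pdf mule1.
- by move=> y _; rewrite lee_fin normal_pdf_ge0.
- by apply/measurable_EFinP; exact: measurable_normal_pdf.
Qed.

Context {I : finType}.
Variables (X : I -> T -> R) (mu : I -> R).
Hypothesis mX : forall p, measurable_fun setT (X p).
Hypothesis indep : mutually_independent P X.
Hypothesis law : forall p A, measurable A ->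
  P (X p @^-1` A) = normal_prob (mu p) 1 A.

(** Chernoff's bound with the exponential parameter absorbed into [a]: the indicator of the event is
    at most [expR (Z - b)], whose expectation factorizes by independence. *)
Lemma gaussian_linear_tail (a : I -> R) (b : R) :
  (P [set w | (b <= \sum_p a p * (X p w - mu p))%R] <=
   (expR ((\sum_p a p ^+ 2) / 2 - b))%:E)%E.
Proof.
set Z := fun w => \sum_p a p * (X p w - mu p).
have mZ : measurable_fun setT Z.
  apply: measurable_sum => p; apply: measurable_funM => //.
  exact: measurable_funB.
have mD : measurable [set w | b <= Z w].
  by rewrite -[X in measurable X]setTI; exact: measurable_fun_le.
rewrite -(setIT [set w | b <= Z w]) -integral_indic//.
apply: (@le_trans _ _ (\int[P]_w ((expR (- b))%:E * (expR (Z w))%:E))%E).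
  apply: ge0_le_integral => //.
  - exact/measurable_EFinP.
  - apply/measurable_EFinP; apply: measurable_funM => //.
    exact: measurableT_comp.
  - move=> w _; rewrite -EFinM lee_fin -expRD indicE.
    case: (boolP (w \in _)) => [/set_mem /= bZ|_]; last exact: expR_ge0.
    by rewrite -expR0 ler_expR addrC subr_ge0.
rewrite ge0_integralZl_EFin ?expR_ge0//; last first.
  by apply/measurable_EFinP; exact: measurableT_comp.
pose h p y := expR (a p * (y - mu p)).
have mh p : measurable_fun setT (h p).
  apply: measurableT_comp => //; apply: measurable_funM => //.
  exact: measurable_funB.
have hE p : (\int[P]_w (h p (X p w))%:E = (expR (a p ^+ 2 / 2))%:E)%E.
  by apply: normal_law_mgf => // A; exact: law.
under eq_integral do rewrite /Z expR_sum.
rewrite (independent_integral_prod P I X mX h)//; last 2 first.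
- by move=> p y; exact: expR_ge0.
- by move=> p; rewrite hE ltry.
under eq_bigr do rewrite hE.
by rewrite prodEFin -expR_sum -EFinM -expRD addrC -mulr_suml.
Qed.

Lemma gaussian_sum_tail (A : {set I}) (c : R) : (0 < #|A|)%N -> 0 <= c ->
  (P [set w | (c <= `|\sum_(p in A) (X p w - mu p)|)%R] <=
   (2 * expR (- (c ^+ 2 / (2 * #|A|%:R))))%:E)%E.
Proof.
move=> A0 c0; have Anz : #|A|%:R != 0 :> R by rewrite pnatr_eq0 -lt0n.
(* This [r] minimizes the Chernoff exponent [#|A| * r ^+ 2 / 2 - r * c]. The sign [e] below, equal
   to 1 or -1, selects the upper or lower tail. *)
pose r := c / #|A|%:R; have r0 : 0 <= r by rewrite divr_ge0.
pose a (e : R) p := if p \in A then e * r else 0.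
have aE e w : \sum_p a e p * (X p w - mu p) =
    e * (r * \sum_(p in A) (X p w - mu p)).
  rewrite !mulr_sumr [RHS]big_mkcond/=; apply: eq_bigr => p _.
  by rewrite /a; case: ifP => _; rewrite ?mul0r// mulrA.
have tail e : e ^+ 2 = 1 ->
    (P [set w | (r * c <= e * (r * \sum_(p in A) (X p w - mu p)))%R] <=
     (expR (- (c ^+ 2 / (2 * #|A|%:R))))%:E)%E.
  move=> e2; have := gaussian_linear_tail (a e) (r * c).
  under eq_set do rewrite aE; move=> /le_trans; apply; rewrite lee_fin ler_expR.
  have -> : \sum_p a e p ^+ 2 = #|A|%:R * r ^+ 2.
    rewrite mulr_natl -sumr_const [RHS]big_mkcond/=; apply: eq_bigr => p _.
    by rewrite /a; case: ifP => _; rewrite ?expr0n// exprMn e2 mul1r.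
  by rewrite le_eqVlt; apply/orP; left; apply/eqP; rewrite /r; field.
have mS : measurable_fun setT (fun w => \sum_(p in A) (X p w - mu p)).
  under eq_fun do rewrite big_mkcond/=.
  apply: measurable_sum => p; case: (p \in A) => //; exact: measurable_funB.
have mT e : measurable
    [set w | (r * c <= e * (r * \sum_(p in A) (X p w - mu p)))%R].
  rewrite -[X in measurable X]setTI; apply: measurable_fun_le => //.
  by apply: measurable_funM => //; exact: measurable_funM.
apply: (@le_trans _ _ (P ([set w | (r * c <= 1 * (r * \sum_(p in A) (X p w - mu p)))%R]
   `|` [set w | (r * c <= -1 * (r * \sum_(p in A) (X p w - mu p)))%R]))).
  apply: le_measure; rewrite ?inE//.
  - rewrite -[X in measurable X]setTI; apply: measurable_fun_le => //.
    exact: measurableT_comp.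
  - exact: measurableU.
  - move=> w /=; rewrite mul1r mulN1r -mulrN.
    by case: (ger0P (\sum_(p in A) _)) => _ /(ler_wpM2l r0); [left|right].
apply: le_trans (measureU2 _ _ _) _ => //.
by rewrite mulr_natl mulr2n EFinD; apply: leeD; apply: tail; rewrite ?sqrrN expr1n.
Qed.

End gaussian.

(** * Deterministic error bounds, given the deviations of the sample means *)

Section error_bounds.
Context {R : realType} {m n : nat}.
Variables (x : 'I_m -> 'I_n -> R) (thstar : 'I_m -> R) (S : {set 'I_m}).
Variables (lam q c : R) (ths : 'I_m -> R) (th : R).

(** The triangle inequality through the sample mean gives [lam + 2 * q]; multiplied by [1 - 2 * c],
    this is at most [8 * q + 2 * q]. *)
Lemma minimizer_error_all j :
  (0 < n)%N -> 0 < q -> 0 <= c -> c < 2^-1 ->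
  0 <= lam -> (1 - 2 * c) * lam <= 8 * q ->
  is_minimizer lam x ths th ->
  `|sample_mean (x j) - thstar j| <= 2 * q ->
  `|ths j - thstar j| <= 10 * q / (1 - 2 * c).
Proof.
move=> n0 q0 c0 c_half lam0 lam_le min dev.
have c2 : 0 < 1 - 2 * c by lra.
have := minimizer_residual_le _ _ _ _ j n0 lam0 min; move: dev.
rewrite distrC [`|_ - ths j|]distrC => d1 d2.
rewrite ler_pdivlMr//.
have : `|ths j - thstar j| <= lam + 2 * q.
  rewrite (le_trans (ler_distD (sample_mean (x j)) _ _))// lerD// distrC.
  by rewrite distrC [leLHS]distrC.
have qc : 0 <= q * c by rewrite mulr_ge0// ltW.
move=> /(ler_wpM2r (ltW c2)); lra.
Qed.

(** The three terms come from the residuals outside [S], the averaged noise over [S], and the spread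
    of the true parameters within [S]. *)
Lemma minimizer_error_consensus (eps delta v th0 : R) j :
  (0 < m)%N -> (0 < n)%N -> 0 < q -> 0 <= eps -> eps <= c -> c < 2^-1 ->
  0 <= lam -> 7 * q <= (1 - 2 * c) * lam -> (1 - 2 * c) * lam <= 8 * q ->
  is_minimizer lam x ths th ->
  (forall k, `|sample_mean (x k) - thstar k| <= 2 * q) ->
  #|~: S|%:R <= eps * m%:R ->
  delta <= q -> (forall k, k \in S -> `|thstar k - th0| <= delta) ->
  `|\sum_(k in S) (sample_mean (x k) - thstar k)| <= #|S|%:R * v ->
  j \in S ->
  `|ths j - thstar j| <= 16 * eps * q / (1 - 2 * c) + v + 2 * delta.
Proof.
move=> m0 n0 q0 eps0 epsc c_half lam0 lam_ge lam_le min dev.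
move=> bad dq close devS jS.
have c2 : 0 < 1 - 2 * c by lra.
have NS : #|S|%:R + #|~: S|%:R = m%:R :> R by rewrite -natrD cardsC card_ord.
have mR : 0 < m%:R :> R by rewrite ltr0n.
set N : R := #|S|%:R in NS devS *; set k : R := #|~: S|%:R in NS bad *.
have k0 : 0 <= k by exact: ler0n.
have epsm : eps * m%:R <= c * m%:R by rewrite ler_wpM2r// ltW.
have cm : c * m%:R < m%:R / 2 by rewrite [ltRHS]mulrC ltr_pM2r.
have N0 : m%:R / 2 < N by lra.
(* Since [k <= c * m], the margin [(m - 2 * k) * lam] is at least [7 * q * m], which beats
   [6 * q * N]. *)
have big : k * lam < N * (lam - 6 * q).
  have e1 : 7 * q * m%:R <= (m%:R - 2 * k) * lam.
    apply: (@le_trans _ _ ((1 - 2 * c) * lam * m%:R)); first by rewrite ler_wpM2r// ltW.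
    rewrite mulrAC ler_wpM2r//; lra.
  have e2 : N * q <= m%:R * q by rewrite ler_wpM2r ?(ltW q0)//; lra.
  have e3 : 0 < m%:R * q by exact: mulr_gt0.
  have -> : N * (lam - 6 * q) = (m%:R - 2 * k) * lam + k * lam - 6 * (N * q).
    by rewrite -NS; ring.
  lra.
have eqth : forall i, i \in S -> ths i = th.
  (* The [6 * q] is [2 * q] for the deviation of each of the two means plus [2 * delta <= 2 * q]
     between their centers. *)
  apply: (minimizer_consensus _ _ _ _ _ (6 * q) n0 lam0 min) => // i l iS lS.
  move: (dev i) (dev l) (close i iS) (close l lS); rewrite !ler_norml.
  by do 4 move=> /andP[? ?]; apply/andP; split; lra.
have center := minimizer_consensus_center _ _ _ _ _ n0 lam0 min eqth.
rewrite -/k in center.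
have spread : `|\sum_(i in S) (thstar i - thstar j)| <= N * (2 * delta).
  rewrite (le_trans (ler_norm_sum _ _ _))// /N [leRHS]mulr_natl -sumr_const.
  apply: ler_sum => i iS; move: (close i iS) (close j jS); rewrite !ler_norml.
  by do 2 move=> /andP[? ?]; apply/andP; split; lra.
have sumE : N * (th - thstar j) = - \sum_(i in S) (sample_mean (x i) - th)
    + \sum_(i in S) (sample_mean (x i) - thstar i)
    + \sum_(i in S) (thstar i - thstar j).
  rewrite /N [LHS]mulr_natl -sumr_const -sumrN -!big_split/=.
  by apply: eq_bigr => i _; ring.
have Npos : 0 < N by lra.
(* Here [k <= eps * m <= 2 * N * eps], because [S] holds more than half of the indices, and
   [lam <= 8 * q / (1 - 2 * c)]. *)
have klam : k * lam <= N * (16 * eps * q / (1 - 2 * c)).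
  have -> : N * (16 * eps * q / (1 - 2 * c)) =
      (2 * N * eps) * (8 * q / (1 - 2 * c)) by ring.
  apply: ler_pM => //; last by rewrite ler_pdivlMr// mulrC.
  rewrite (le_trans bad)// mulrC ler_wpM2r//; lra.
rewrite eqth// -(ler_pM2l Npos) -[X in X * _](gtr0_norm Npos) -normrM sumE.
rewrite (le_trans (ler_normD _ _))// !mulrDr lerD//.
rewrite (le_trans (ler_normD _ _))// normrN lerD//.
exact: le_trans klam.
Qed.

End error_bounds.

(** * Simultaneous concentration of the dataset sums and of the pooled sum *)

Lemma union_bound {R : realType} {d : measure_display} {T : measurableType d}
    (P : probability T R) (J : finType) (bad : J -> set T) (p : J -> R) :
  (forall j, measurable (bad j)) -> (forall j, P (bad j) <= (p j)%:E)%E ->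
  (P (\big[setU/set0]_j bad j) <= (\sum_j p j)%:E)%E.
Proof.
move=> mbad Pbad.
suff [] : measurable (\big[setU/set0]_j bad j) /\
  (P (\big[setU/set0]_j bad j) <= (\sum_j p j)%:E)%E by [].
apply: (big_ind2 (fun A r => measurable A /\ (P A <= r%:E)%E)) => //.
  by rewrite measure0.
move=> A r B s [mA PA] [mB PB]; split; first exact: measurableU.
by rewrite EFinD (le_trans (measureU2 _ _ _))// leeD.
Qed.

Section concentration.
Context {R : realType} {d : measure_display} {T : measurableType d}.
Variables (P : probability T R) (m n : nat).
Variables (x : 'I_m -> 'I_n -> {RV P >-> R}) (thstar : 'I_m -> R).
Hypothesis indep :
  mutually_independent P (fun p : 'I_m * 'I_n => (x p.1 p.2 : T -> R)).
Hypothesis law : forall j i (A : set R), measurable A ->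
  P (x j i @^-1` A) = normal_prob (thstar j) 1 A.

Lemma block_sum_tail (B : {set 'I_m}) (c : R) :
  (0 < #|B|)%N -> (0 < n)%N -> 0 <= c ->
  (P [set w | (c <= `|\sum_(j in B) \sum_(i < n) (x j i w - thstar j)|)%R] <=
   (2 * expR (- (c ^+ 2 / (2 * (#|B|%:R * n%:R)))))%:E)%E.
Proof.
move=> B0 n0 c0.
have mx (p : 'I_m * 'I_n) : measurable_fun setT (x p.1 p.2) by [].
have cardE : #|finset.setX B [set: 'I_n]%SET| = (#|B| * n)%N.
  by rewrite cardsX cardsT card_ord.
have := @gaussian_sum_tail _ _ _ P _ _ (fun p => thstar p.1) mx indep
  (fun p => law p.1 p.2) (finset.setX B [set: 'I_n]%SET) c.
rewrite cardE muln_gt0 B0 n0 natrM => /(_ isT c0).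
congr (P _ <= _)%E; apply/seteqP.
have sumE w : \sum_(p in finset.setX B [set: 'I_n]%SET) (x p.1 p.2 w - thstar p.1)
    = \sum_(j in B) \sum_(i < n) (x j i w - thstar j).
  by rewrite pair_big_dep/=; apply: eq_bigl => -[j i]; rewrite !inE/= andbT.
by split=> w /=; rewrite sumE.
Qed.

Lemma deviation_event (S : {set 'I_m}) (t : R) :
  (2 <= m)%N -> (0 < n)%N -> 1 <= t -> (m <= 2 * #|S|)%N ->
  exists E : set T, measurable E /\ ((1 - expR (- t))%:E <= P E)%E /\
  forall w, E w ->
    (forall j, `|\sum_(i < n) (x j i w - thstar j)| <
       n%:R * (2 * Num.sqrt ((ln m%:R + t) / n%:R))) /\
    `|\sum_(j in S) \sum_(i < n) (x j i w - thstar j)| <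
       #|S|%:R * n%:R * (4 * Num.sqrt (t / (m%:R * n%:R))).
Proof.
move=> m2 n0 t1 mS.
have nR : 0 < n%:R :> R by rewrite ltr0n.
have mR2 : 2 <= m%:R :> R by rewrite ler_nat.
have mR : 0 < m%:R :> R by exact: lt_le_trans mR2.
have S0 : (0 < #|S|)%N by case: #|S| mS => //; rewrite muln0 leqNgt (leq_trans _ m2).
have SR : m%:R <= 2 * #|S|%:R :> R by rewrite -natrM ler_nat.
have SR0 : 0 < #|S|%:R :> R by rewrite ltr0n.
have t0 : 0 <= t by rewrite (le_trans _ t1).
have lnm : 0 <= ln m%:R :> R by rewrite ln_ge0// (le_trans _ mR2)// ler1n.
pose q : R := Num.sqrt ((ln m%:R + t) / n%:R).
pose v : R := Num.sqrt (t / (m%:R * n%:R)).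
have q2 : q ^+ 2 = (ln m%:R + t) / n%:R by rewrite sqr_sqrtr// divr_ge0 ?addr_ge0// ltW.
have v2 : v ^+ 2 = t / (m%:R * n%:R).
  by rewrite sqr_sqrtr// divr_ge0// mulr_ge0// ltW.
have q0 : 0 <= q by exact: sqrtr_ge0.
have v0 : 0 <= v by exact: sqrtr_ge0.
(* [Some j] indexes the deviation of the j-th dataset and [None] that of the data pooled over [S],
   so one union bound covers all [m + 1] events. *)
pose B (o : option 'I_m) := if o is Some j then [set j]%SET else S.
pose c (o : option 'I_m) :=
  if o is Some _ then n%:R * (2 * q) else #|S|%:R * n%:R * (4 * v).
pose p (o : option 'I_m) : R :=
  if o is Some _ then 2 * expR (- (2 * (ln m%:R + t))) else 2 * expR (- (4 * t)).
pose bad o := [set w | c o <= `|\sum_(j in B o) \sum_(i < n) (x j i w - thstar j)|].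
have mbad o : measurable (bad o).
  rewrite -[X in measurable X]setTI; apply: measurable_fun_le => //.
  apply: measurableT_comp => //.
  under eq_fun do rewrite big_mkcond/=.
  apply: measurable_sum => j; case: (j \in B o) => //.
  apply: measurable_sum => i; exact: measurable_funB.
have Pbad o : (P (bad o) <= (p o)%:E)%E.
  apply: le_trans (block_sum_tail (B o) (c o) _ n0 _) _.
  - by case: o => [j|] //=; rewrite cards1.
  - by case: o => [j|] /=; rewrite !mulr_ge0// ltW.
  rewrite lee_fin; case: o => [j|] /=; rewrite ler_pM2l// ler_expR lerN2.
    rewrite cards1 mul1r !exprMn q2.
    by rewrite le_eqVlt; apply/orP; left; apply/eqP; field; rewrite lt0r_neq0.
  rewrite !exprMn v2.
  (* The last factor is at least 1 because [S] contains at least half of the indices. *)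
  have -> : #|S|%:R ^+ 2 * n%:R ^+ 2 * (4 ^+ 2 * (t / (m%:R * n%:R))) /
      (2 * (#|S|%:R * n%:R)) = 4 * t * (2 * #|S|%:R / m%:R) :> R.
    by field; rewrite !lt0r_neq0.
  by rewrite ler_peMr ?mulr_ge0// ler_pdivlMr// mul1r.
(* With [e = expR (- t)], the sum is [2 * e ^+ 4 + 2 / m * e ^+ 2]. As [t >= 1] gives [e <= 1/2] and
   [m >= 2], each term is at most [e / 2]. *)
have sum_p : \sum_o p o <= expR (- t).
  rewrite (bigD1 None)//= (eq_bigr (fun=> 2 * expR (- (2 * (ln m%:R + t))))); last first.
    by case.
  rewrite sumr_const cardC1 card_option card_ord [_.+1.-1]/=.
  set e := expR (- t); have e0 : 0 < e by exact: expR_gt0.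
  have e_half : e <= 2^-1.
    rewrite /e expRN lef_pV2 ?posrE ?expR_gt0//.
    by rewrite (le_trans _ (expR_ge1Dx t))//; lra.
  have -> : expR (- (4 * t)) = e ^+ 4.
    by rewrite -expRM_natl mulrN.
  have -> : expR (- (2 * (ln m%:R + t))) = m%:R^-1 ^+ 2 * e ^+ 2.
    rewrite -exprMn -[m%:R in RHS]lnK ?posrE// -expRN -expRD -expRM_natl.
    by congr expR; ring.
  have -> : 2 * (m%:R^-1 ^+ 2 * e ^+ 2) *+ m = 2 / m%:R * e ^+ 2.
    by rewrite -mulr_natl; field; rewrite lt0r_neq0.
  have : 2 / m%:R * e ^+ 2 <= e ^+ 2.
    by rewrite ler_piMl ?sqr_ge0// ler_pdivrMr// mul1r.
  have sq_half y : 0 <= y -> y <= e -> y * e <= e / 2.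
    by move=> y0 ye; rewrite mulrC ler_pM2l// (le_trans ye).
  have e2 : e ^+ 2 <= e / 2 by rewrite expr2 sq_half// ltW.
  have e4 : e ^+ 4 <= e / 4.
    have -> : e / 4 = (e / 2) / 2 by field.
    rewrite (exprM e 2 2) expr2; apply: (@le_trans _ _ (e / 2 * 2^-1)) => //.
    by apply: ler_pM => //; rewrite ?sqr_ge0// (le_trans e2)//; lra.
  lra.
exists (~` \big[setU/set0]_o bad o); split.
  by apply: measurableC; exact: bigsetU_measurable.
split.
  rewrite probability_setC; last exact: bigsetU_measurable.
  rewrite EFinB leeB// (le_trans (union_bound P _ _ _ mbad Pbad))//.
move=> w Ew; have nbad o : ~ bad o w.
  by move=> bo; apply: Ew; rewrite -bigcup_seq; exists o => //=; rewrite mem_index_enum.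
split=> [j|].
  have := nbad (Some j); rewrite /bad /= big_set1 => /negP.
  by rewrite -ltNge.
by have := nbad None; rewrite /bad /= => /negP; rewrite -ltNge.
Qed.

End concentration.

(** * Choice of constants and combination of the two regimes of [delta] *)

Theorem theorem2p2 (R : realType) :
  exists C : R, 0 < C /\
  forall (m n : nat) (eps delta : R) (thstar : 'I_m -> R) (S : {set 'I_m})
    (t c : R) (d : measure_display) (T : measurableType d)
    (P : probability T R) (x : 'I_m -> 'I_n -> {RV P >-> R}),
    (2 <= m)%N -> (1 <= n)%N ->
    0 <= eps -> eps < 2^-1 -> 0 <= delta ->
    mutually_independent P (fun p : 'I_m * 'I_n => (x p.1 p.2 : T -> R)) ->
    (forall j i (A : set R), measurable A ->
       P (x j i @^-1` A) = normal_prob (thstar j) 1 A) ->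
    #|~: S|%:R / m%:R <= eps ->
    (exists th0 : R, forall j, j \in S -> `|thstar j - th0| <= delta) ->
    1 <= t -> eps <= c -> c < 2^-1 ->
    let lam := 5 / (1 - 2 * c) * Num.sqrt (2 * (ln m%:R + t) / n%:R) in
    exists E : set T, measurable E /\
      ((1 - expR (- t))%:E <= P E)%E /\
      forall w, E w ->
      forall (ths : 'I_m -> R) (th : R),
        is_minimizer lam (fun j i => x j i w) ths th ->
        (forall j, j \in S ->
           `|ths j - thstar j| <
             C / (1 - 2 * c) ^+ 2 *
             (Num.sqrt (t / (m%:R * n%:R))
              + Num.min delta (Num.sqrt ((ln m%:R + t) / n%:R))
              + eps * Num.sqrt ((ln m%:R + t) / n%:R))) /\
        (forall j, j \notin S ->
           `|ths j - thstar j| <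
             C / (1 - 2 * c) ^+ 2 * Num.sqrt ((ln m%:R + t) / n%:R)).
Proof.
(* The constant 20 dominates the 10 of the coarse bound and the 16, 4 and 2 of the consensus bound,
   with slack for strictness. *)
exists 20; split=> // m n eps delta thstar S t c d T P x m2 n1 eps0 eps_half delta0.
move=> indep law badS [th0 close] t1 epsc c_half lam.
have m0 : (0 < m)%N by exact: leq_trans m2.
have mR : 0 < m%:R :> R by rewrite ltr0n.
have nR : 0 < n%:R :> R by rewrite ltr0n.
have bad : #|~: S|%:R <= eps * m%:R by rewrite -ler_pdivrMr.
have mS : (m <= 2 * #|S|)%N.
  have NS : #|S|%:R + #|~: S|%:R = m%:R :> R by rewrite -natrD cardsC card_ord.
  rewrite -(ler_nat R) natrM.
  have : eps * m%:R <= 2^-1 * m%:R by rewrite ler_wpM2r// ltW.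
  lra.
have [E [mE [PE HE]]] := deviation_event P m n x thstar indep law S t m2 n1 t1 mS.
exists E; split=> //; split=> // w /HE[devj devS] ths th min.
set q := Num.sqrt ((ln m%:R + t) / n%:R) in devj devS *.
set v := Num.sqrt (t / (m%:R * n%:R)) in devS *.
have t0 : 0 < t by exact: lt_le_trans t1.
have q0 : 0 < q.
  by rewrite sqrtr_gt0 divr_gt0// ltr_wpDl// ln_ge0// ler1n.
have v0 : 0 < v by rewrite sqrtr_gt0 divr_gt0// mulr_gt0.
have c2 : 0 < 1 - 2 * c by lra.
have lamE : (1 - 2 * c) * lam = 5 * (Num.sqrt 2 * q).
  rewrite /lam -(mulrA 2 (_ + t)) sqrtrM// -/q; field; lra.
(* The factor 5 in [lam] turns these bounds into the 7 and 8 required by the error lemmas. *)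
have sqrt2 : 7 / 5 <= (Num.sqrt 2 : R) <= 8 / 5.
  have s0 := sqrtr_ge0 (2 : R); have s2 : Num.sqrt 2 ^+ 2 = 2 :> R by rewrite sqr_sqrtr.
  by apply/andP; split; nra.
have /andP[sge sle] := sqrt2.
have lam_ge : 7 * q <= (1 - 2 * c) * lam.
  by rewrite lamE mulrA ler_wpM2r ?(ltW q0)//; lra.
have lam_le : (1 - 2 * c) * lam <= 8 * q.
  by rewrite lamE mulrA ler_wpM2r ?(ltW q0)//; lra.
have lam0 : 0 <= lam by rewrite mulr_ge0 ?sqrtr_ge0// divr_ge0// ltW.
have meanE j : sample_mean (x j ^~ w) - thstar j =
    (\sum_(i < n) (x j i w - thstar j)) / n%:R.
  rewrite /sample_mean sumrB sumr_const card_ord -mulr_natl; field; exact: lt0r_neq0.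
have dev j : `|sample_mean (x j ^~ w) - thstar j| <= 2 * q.
  rewrite meanE normrM normfV (gtr0_norm nR) ler_pdivrMr// mulrC.
  exact: ltW.
have devS' : `|\sum_(k in S) (sample_mean (x k ^~ w) - thstar k)| <= #|S|%:R * (4 * v).
  under eq_bigr do rewrite meanE.
  rewrite -mulr_suml normrM normfV (gtr0_norm nR) ler_pdivrMr// mulrAC.
  exact: ltW.
have c0 : 0 <= c by exact: le_trans epsc.
have all_bound j := minimizer_error_all _ _ lam q c _ th j n1 q0 c0 c_half lam0 lam_le min (dev j).
set K := (1 - 2 * c)^-1 in all_bound.
(* Since [c >= 0], every factor [K] or 1 in the bounds may be enlarged to [K ^+ 2]. *)
have K1 : 1 <= K by rewrite invf_ge1//; lra.
have K2 : K <= K ^+ 2 by rewrite expr2 ler_peMr// (le_trans _ K1).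
have CE : 20 / (1 - 2 * c) ^+ 2 = 20 * K ^+ 2 by rewrite exprVn.
have coarse j : `|ths j - thstar j| < 20 * K ^+ 2 * q.
  apply: le_lt_trans (all_bound j) _.
  by rewrite mulrAC ltr_pM2r//; lra.
rewrite CE; split=> j jS; last exact: coarse.
have Kpos : 0 < 20 * K ^+ 2 by lra.
have epsq : 0 <= eps * q by rewrite mulr_ge0// ltW.
(* For [delta > q] the minimum equals [q], and the coarse bound already suffices on [S]. *)
have [dq|qd] := leP delta q.
  have fine := minimizer_error_consensus (fun k i => x k i w) thstar S lam q c ths th
    eps delta (4 * v) th0 j m0 n1 q0 eps0 epsc c_half lam0 lam_ge lam_le min dev
    bad dq close devS' jS.
  apply: le_lt_trans fine _.
  have h1 : 16 * eps * q / (1 - 2 * c) <= 20 * K ^+ 2 * (eps * q).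
    have -> : 16 * eps * q / (1 - 2 * c) = 16 * K * (eps * q) by rewrite -/K; ring.
    by rewrite ler_wpM2r//; lra.
  have h2 : 4 * v < 20 * K ^+ 2 * v by rewrite ltr_pM2r//; lra.
  have h3 : 2 * delta <= 20 * K ^+ 2 * delta by rewrite ler_wpM2r//; lra.
  rewrite !mulrDr; lra.
apply: lt_le_trans (coarse j) _; rewrite ler_pM2l//; lra.
Qed.
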